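(* For all integers $1\leq k\leq n$, \[ S_{n,k}=\sum_{r=k-1}^{n-1}(-1)^{n-1-r}\binom{2n-2-r}{k-1}X_1^{r}\,\widetilde{B}_{2n-1-k-r,\;n-1-r}. \]
   Context: Let $R=\mathbb{Z}[X_1,X_1^{-1},X_2,X_3,\ldots]$ (Laurent in $X_1$, polynomial in the other indeterminates). Partial exponential Bell polynomials: $B_{0,0}=1$, $B_{n,0}=0$ for $n\geq1$, $B_{n,k}=0$ for $0\leq n<k$, and for $1\leq k\leq n$ \[B_{n,k}=\sum \frac{n!}{r_1!r_2!\cdots r_{n-k+1}!\,(1!)^{r_1}(2!)^{r_2}\cdots((n-k+1)!)^{r_{n-k+1}}}X_1^{r_1}X_2^{r_2}\cdots X_{n-k+1}^{r_{n-k+1}},\] the sum over all nonnegative integers $r_1,\ldots,r_{n-k+1}$ with $\sum_i r_i=k$ and $\sum_i i\,r_i=n$. The associated Bell polynomial $\widetilde{B}_{n,k}$ is $B_{n,k}$ with $X_1$ replaced by $0$. Elements $S_{n,k}\in R$ ($n,k\geq0$; multivariate Stirling polynomials of the first kind) are defined by $S_{0,0}=X_1^{-1}$, $S_{n,0}=0$ for $n\geq1$, $S_{n,k}=0$ for $0\leq n<k$, and for $n\geq0$, $1\leq k\leq n+1$: \[S_{n+1,k}=-(2n-1)X_2S_{n,k}+X_1\Big(S_{n,k-1}+\sum_{j=1}^{n-k+1}X_{j+1}\frac{\partial S_{n,k}}{\partial X_j}\Big).\] *)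

(* Defs.v *)
From HB Require Import structures.
From mathcomp Require Import all_boot all_order all_algebra finmap.
From mathcomp.multinomials Require Import monalg.

Set Implicit Arguments.
Unset Strict Implicit.
Unset Printing Implicit Defensive.

Import GRing.Theory.
Local Open Scope fset_scope.
Local Open Scope ring_scope.

(* The ring structure that monalg puts on {malg G[K]} asks that K have no   *)
(* invertible monomial but the unit, which excludes negative exponents. The *)
(* same convolution product is therefore studied here for an arbitrary      *)
(* commutative monoid (K, e, m).                                            *)
Section Convolution.

Variables (K : choiceType) (A : comNzRingType) (e : K) (m : K -> K -> K).
Implicit Types (f g h : {malg A[K]}) (u v : K) (a b : A).

Definition convol f g : {malg A[K]} :=
  \sum_(u <- msupp f) \sum_(v <- msupp g) << f@_u * g@_v *g m u v >>.

Lemma convolEw (d1 d2 : {fset K}) f g : msupp f `<=` d1 -> msupp g `<=` d2 ->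
  convol f g = \sum_(u <- d1) \sum_(v <- d2) << f@_u * g@_v *g m u v >>.
Proof.
move=> le1 le2; rewrite /convol (big_fset_incl _ le1) /=.
  apply/eq_bigr=> u _; apply/big_fset_incl => // v _ /mcoeff_outdom ->.
  by rewrite mulr0 monalgU0.
move=> u _ /mcoeff_outdom fu.
by rewrite big1 => // v _; rewrite fu mul0r monalgU0.
Qed.

Lemma convolUU a b u v :
  convol << a *g u >> << b *g v >> = << a * b *g m u v >>.
Proof. by rewrite (convolEw msuppU_le msuppU_le) !big_seq_fset1 !mcoeffUU. Qed.

Lemma convolDl : left_distributive convol +%R.
Proof.
move=> f1 f2 g.
rewrite (convolEw (msuppD_le f1 f2) (fsubset_refl _)).
rewrite (convolEw (fsubsetUl (msupp f1) (msupp f2)) (fsubset_refl _)).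
rewrite (convolEw (fsubsetUr (msupp f1) (msupp f2)) (fsubset_refl _)).
rewrite -big_split /=; apply/eq_bigr=> u _.
rewrite -big_split /=; apply/eq_bigr=> v _.
by rewrite mcoeffD mulrDl monalgUD.
Qed.

Lemma convol0l : left_zero 0 convol.
Proof. by move=> g; rewrite /convol msupp0 big_seq_fset0. Qed.

Hypotheses (mA : associative m) (mC : commutative m) (m1 : left_id e m).

Lemma convolC : commutative convol.
Proof.
move=> f g; rewrite /convol exchange_big /=.
by apply/eq_bigr=> v _; apply/eq_bigr=> u _; rewrite mulrC mC.
Qed.

Lemma convolDr : right_distributive convol +%R.
Proof. by move=> f g h; rewrite !(convolC f) convolDl. Qed.

Lemma convol0r : right_zero 0 convol.
Proof. by move=> f; rewrite convolC convol0l. Qed.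

Lemma convol_suml (I : Type) (r : seq I) (F : I -> {malg A[K]}) g :
  convol (\sum_(i <- r) F i) g = \sum_(i <- r) convol (F i) g.
Proof.
exact: (big_morph (convol^~ g) (fun _ _ => convolDl _ _ _) (convol0l g)).
Qed.

Lemma convol_sumr (I : Type) (r : seq I) (F : I -> {malg A[K]}) f :
  convol f (\sum_(i <- r) F i) = \sum_(i <- r) convol f (F i).
Proof. exact: (big_morph (convol f) (fun _ _ => convolDr _ _ _) (convol0r f)). Qed.

Lemma convolEl f g : convol f g = \sum_(u <- msupp f) convol << f@_u *g u >> g.
Proof. by rewrite -convol_suml -monalgE. Qed.

Lemma convolEr f g : convol f g = \sum_(v <- msupp g) convol f << g@_v *g v >>.
Proof. by rewrite -convol_sumr -monalgE. Qed.

Lemma convolA : associative convol.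
Proof.
move=> f g h; rewrite [LHS]convolEl (convolEl f g).
rewrite [RHS]convol_suml; apply/eq_bigr=> u _.
rewrite (convolEl g h) [LHS]convol_sumr.
rewrite (convolEr _ g) [RHS]convol_suml; apply/eq_bigr=> v _.
rewrite (convolEr _ h) [LHS]convol_sumr convolUU.
rewrite [RHS]convolEr; apply/eq_bigr=> w _.
by rewrite !convolUU mulrA mA.
Qed.

Lemma convol1l : left_id << 1 *g e >> convol.
Proof.
move=> f; rewrite convolEr [RHS]monalgE; apply/eq_bigr=> u _.
by rewrite convolUU mul1r m1.
Qed.

(* The linear map u |-> (x u) *: (d u); when x is the exponent of an        *)
(* indeterminate and d the division by it, this is the formal derivative.   *)
Variables (x : K -> A) (d : K -> K).

Definition mderive f : {malg A[K]} :=
  \sum_(u <- msupp f) << f@_u * x u *g d u >>.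

Lemma mderiveEw (s : {fset K}) f : msupp f `<=` s ->
  mderive f = \sum_(u <- s) << f@_u * x u *g d u >>.
Proof.
move=> le_s; rewrite /mderive (big_fset_incl _ le_s) //= => u _.
by move=> /mcoeff_outdom ->; rewrite mul0r monalgU0.
Qed.

Lemma mderiveU a u : mderive << a *g u >> = << a * x u *g d u >>.
Proof. by rewrite (mderiveEw msuppU_le) big_seq_fset1 mcoeffUU. Qed.

Lemma mderiveD : {morph mderive : f g / f + g}.
Proof.
move=> f g; rewrite (mderiveEw (msuppD_le f g)).
rewrite (mderiveEw (fsubsetUl (msupp f) (msupp g))).
rewrite (mderiveEw (fsubsetUr (msupp f) (msupp g))).
rewrite -big_split /=; apply/eq_bigr=> u _.
by rewrite mcoeffD mulrDl monalgUD.
Qed.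

Lemma mderive0 : mderive 0 = 0.
Proof. by rewrite /mderive msupp0 big_seq_fset0. Qed.

Lemma mderive_sum (I : Type) (r : seq I) (F : I -> {malg A[K]}) :
  mderive (\sum_(i <- r) F i) = \sum_(i <- r) mderive (F i).
Proof. exact: (big_morph mderive mderiveD mderive0). Qed.

Hypothesis xM : forall u v, x (m u v) = x u + x v.
Hypothesis dM : forall u v, x u != 0 -> d (m u v) = m (d u) v.

Lemma mderiveM f g :
  mderive (convol f g) = convol (mderive f) g + convol f (mderive g).
Proof.
have UU a b u v : mderive (convol << a *g u >> << b *g v >>) =
    convol (mderive << a *g u >>) << b *g v >>
    + convol << a *g u >> (mderive << b *g v >>).
  rewrite convolUU !mderiveU !convolUU xM mulrDr monalgUD; congr (_ + _).
    have [->|u0] := eqVneq (x u) 0; first by rewrite !(mulr0, mul0r) !monalgU0.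
    by rewrite dM // mulrAC.
  have [->|v0] := eqVneq (x v) 0; first by rewrite !mulr0 !monalgU0.
  by rewrite mC dM // mC mulrA.
have U a u : mderive (convol << a *g u >> g) =
    convol (mderive << a *g u >>) g + convol << a *g u >> (mderive g).
  rewrite (convolEr << a *g u >> g) mderive_sum.
  rewrite (eq_bigr _ (fun v _ => UU a g@_v u v)) big_split /=.
  by rewrite -!convol_sumr -mderive_sum -monalgE.
rewrite (convolEl f g) mderive_sum.
rewrite (eq_bigr _ (fun u _ => U f@_u u)) big_split /=.
by rewrite -!convol_suml -mderive_sum -monalgE.
Qed.

End Convolution.

(* The pair (a, m) stands for X_1^a * X_2^(m 0) * X_3^(m 1) * ...           *)
Notation lmonom := (int * {cmonom nat})%type.

Definition lone : lmonom := (0, onecm nat).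
Definition lmul (u v : lmonom) : lmonom := (u.1 + v.1, mulcm u.2 v.2).

Lemma lmulA : associative lmul.
Proof. by move=> u v w; rewrite /lmul /= addrA mulcmA. Qed.

Lemma lmulC : commutative lmul.
Proof. by move=> u v; rewrite /lmul /= addrC mulcmC. Qed.

Lemma lmul1m : left_id lone lmul.
Proof. by case=> a m; rewrite /lmul /= add0r mul0cm. Qed.

Definition laurent : Type := {malg int[lmonom]}.
HB.instance Definition _ := GRing.Zmodule.on laurent.

Lemma laurent_oner_neq0 : (<< 1 *g lone >> : laurent) != 0.
Proof. by rewrite monalgU_eq0 oner_eq0. Qed.

HB.instance Definition _ := GRing.Zmodule_isComNzRing.Build laurent
  (convolA lmulA lmulC) (convolC lmulC) (convol1l lmulC lmul1m)
  (@convolDl _ _ lmul) laurent_oner_neq0.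

(* Unfolding << a *g u >> compares the keys of finite maps and is costly,   *)
(* hence the lock.                                                          *)
HB.lock Definition lterm (a : int) (u : lmonom) : laurent := << a *g u >>.

Lemma ltermM a b u v : lterm a u * lterm b v = lterm (a * b) (lmul u v).
Proof. by rewrite lterm.unlock; exact: convolUU. Qed.

Lemma lterm1 : lterm 1 lone = 1.
Proof. by rewrite lterm.unlock. Qed.

Lemma lterm0 u : lterm 0 u = 0.
Proof. by rewrite lterm.unlock; exact: monalgU0. Qed.

Lemma ltermN a u : lterm (- a) u = - lterm a u.
Proof. by rewrite lterm.unlock; exact: monalgUN. Qed.

Lemma ltermE (f : laurent) : f = \sum_(u <- msupp f) lterm f@_u u.
Proof. by rewrite lterm.unlock; exact: monalgE. Qed.

(* Indeterminates are numbered from 1; X 0 is a junk value.                 *)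
Definition X (i : nat) : laurent :=
  match i with
  | 0 => 0
  | 1 => lterm 1 (1, onecm nat)
  | j.+2 => lterm 1 (0, ucm j)
  end.

Definition X1inv : laurent := lterm 1 (-1, onecm nat).

Lemma X1invK : X 1 * X1inv = 1.
Proof. by rewrite ltermM /lmul /= subrr mul0cm mulr1 lterm1. Qed.

Definition lexpo (j : nat) (u : lmonom) : int :=
  match j with
  | 0 => 0
  | 1 => u.1
  | i.+2 => (u.2 i)%:Z
  end.

(* The monomial u / X_j; when j >= 2 and u has no X_j it is u itself, which *)
(* only occurs below with coefficient 0.                                    *)
Definition ldiv (j : nat) (u : lmonom) : lmonom :=
  match j with
  | 0 => u
  | 1 => (u.1 - 1, u.2)
  | i.+2 => (u.1, divcm u.2 (ucm i))
  end.

Lemma lexpoM j u v : lexpo j (lmul u v) = lexpo j u + lexpo j v.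
Proof. by case: j => [|[|i]] //=; rewrite mulcmE PoszD. Qed.

Lemma ldivM j u v : lexpo j u != 0 -> ldiv j (lmul u v) = lmul (ldiv j u) v.
Proof.
case: j => [|[|i]] //= ui0; rewrite /lmul /=; first by rewrite addrAC.
congr (_, _); apply/eqP/cmP=> l; rewrite divcmE !mulcmE divcmE ucmE.
by have [<-|_] := eqVneq i l; rewrite ?subn0 // addnBAC // lt0n.
Qed.

Definition pderiv (j : nat) (f : laurent) : laurent :=
  mderive (lexpo j) (ldiv j) f.

Lemma pderivD j : {morph pderiv j : f g / f + g}.
Proof. exact: mderiveD. Qed.

Lemma pderiv0 j : pderiv j 0 = 0.
Proof. exact: mderive0. Qed.

Lemma pderivM j f g : pderiv j (f * g) = pderiv j f * g + f * pderiv j g.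
Proof. exact: (mderiveM lmulC (lexpoM j) (@ldivM j)). Qed.

Lemma pderiv_term j a u : pderiv j (lterm a u) = lterm (a * lexpo j u) (ldiv j u).
Proof. by rewrite lterm.unlock; exact: mderiveU. Qed.

Lemma pderivX i j : (0 < i)%N -> (0 < j)%N -> pderiv j (X i) = (i == j)%:R.
Proof.
case: i j => [|[|i]] [|[|j]] //= _ _; rewrite pderiv_term mul1r /=.
- by rewrite subrr lterm1.
- by rewrite onecmE lterm0.
- by rewrite lterm0.
rewrite ucmE !eqSS; have [->|_] := eqVneq i j; last by rewrite lterm0.
rewrite (_ : divcm _ _ = onecm nat) ?lterm1 //.
by apply/eqP/cmP=> l; rewrite divcmE onecmE subnn.
Qed.

Lemma pderiv1_X1inv : pderiv 1 X1inv = - X1inv ^+ 2.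
Proof. by rewrite pderiv_term expr2 ltermM /lmul /= mul0cm mul1r mulr1 ltermN. Qed.

(* The partial exponential Bell polynomial B_{n,k} evaluated at x_1, x_2,   *)
(* ... in a commutative ring. The i-th component of r is r_{i+1}; as the    *)
(* r_i add up to k, each is at most k. The division is exact.               *)
Definition bell_at (A : comNzRingType) (x : nat -> A) (n k : nat) : A :=
  if k == 0%N then (n == 0%N)%:R
  else if (n < k)%N then 0
  else \sum_(r : {ffun 'I_(n - k + 1) -> 'I_k.+1}
             | (\sum_(i < n - k + 1) r i == k)%N
               && (\sum_(i < n - k + 1) i.+1 * r i == n)%N)
         (n`! %/ \prod_(i < n - k + 1) ((r i)`! * i.+1`! ^ r i))%N%:R
           * \prod_(i < n - k + 1) x i.+1 ^+ r i.

Definition bell (n k : nat) : laurent := bell_at X n k.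

Definition assoc_bell (n k : nat) : laurent :=
  bell_at (fun i => if i == 1%N then 0 else X i) n k.

Fixpoint stirling (n k : nat) : laurent :=
  match n with
  | 0 => if k == 0%N then X1inv else 0
  | m.+1 =>
    if (k == 0%N) || (m.+1 < k)%N then 0
    else - ((2 * m)%:R - 1) * X 2 * stirling m k
         + X 1 * (stirling m k.-1
                  + \sum_(1 <= j < (m.+1 - k).+1)
                      X j.+1 * pderiv j (stirling m k))
  end.

(* Main.v *)
(* Let b_{n,k} be the associated Bell polynomials and D the derivation sending
   X_j to X_{j+1}. Splitting off one part of a partition gives the recurrence
     B_{n+1,k+1} = sum_i C(n,i) x_{i+1} B_{n-i,k},
   and, by induction, d B_{n,k+1} = sum_j C(n,j) (d x_j) B_{n-j,k} for every
   derivation d. As D does not commute with setting X_1 to 0, the two combine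
   into D b_{n,k+1} = b_{n+1,k+1} - n X_2 b_{n-1,k}. Substituted into the
   recurrence defining S_{n,k}, this makes the terms containing X_2 cancel by
   (N-q) C(N,q) = N C(N-1,q), while the others recombine by Pascal's rule. *)
Require Import Defs.
From mathcomp Require Import all_boot all_order all_algebra.
From mathcomp Require Import zify ring.
Import GRing.Theory.
Local Open Scope ring_scope.

(** Reindexing along maps that are mutually inverse only on the two predicates. *)
Lemma big_bij (V : nmodType) (I J : finType) (P : pred I) (Q : pred J)
    (h : I -> J) (h' : J -> I) (F : I -> V) (G : J -> V) :
    (forall i, P i -> [/\ Q (h i), h' (h i) = i & F i = G (h i)]) ->
    (forall j, Q j -> P (h' j) /\ h (h' j) = j) ->
  \sum_(i | P i) F i = \sum_(j | Q j) G j.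
Proof.
move=> hP hQ; rewrite [RHS](reindex_onto h h') => [|j /hQ[]//].
rewrite [RHS](eq_bigl P); first by apply: eq_bigr => i /hP[].
move=> i; apply/andP/idP => [[/hQ[Pi _] /eqP <-] //|/hP[-> -> _]].
by rewrite eqxx.
Qed.

(** * Partitions as bounded multiplicity vectors, and their multinomial coefficients *)

Section Box.
Context {N K : nat}.
Implicit Types r : {ffun 'I_N -> 'I_K.+1}.

(* r i is the number of parts of size i+1 of a partition. *)
Definition parts r : nat := \sum_(i < N) r i.
Definition weight r : nat := \sum_(i < N) i.+1 * r i.
Definition symm r : nat := \prod_(i < N) ((r i)`! * i.+1`! ^ r i).

Lemma symm_gt0 r : (0 < symm r)%N.
Proof. by apply: prodn_gt0 => i; rewrite muln_gt0 expn_gt0 !fact_gt0. Qed.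

(** The quotient counts the splittings of a set into r blocks of size i+1; the induction chooses the
    block of one fixed element. *)
Lemma fact_expn_dvd (i r : nat) : (r`! * i.+1`! ^ r %| (i.+1 * r)`!)%N.
Proof.
elim: r => [|r IH]; first by rewrite muln0.
have le : (i.+1 <= i.+1 * r.+1)%N by rewrite leq_pmulr.
rewrite -(bin_fact le) mulnS.
have -> : 'C(i.+1 + i.+1 * r, i.+1) = (r.+1 * 'C(i + i.+1 * r, i))%N.
  apply/eqP; rewrite -(eqn_pmul2l (ltn0Sn i)) mulnA -mul_bin_diag mulnS.
  by rewrite addSn.
rewrite factS expnS.
rewrite (_ : (_ * _)%N = (r.+1 * i.+1`! * (r`! * i.+1`! ^ r))%N); last by ring.
rewrite addKn [X in (_ %| X)%N]mulnA.
by rewrite dvdn_mul // [X in (_ %| X)%N]mulnAC dvdn_mulr.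
Qed.

Lemma prod_fact_dvd (I : Type) (s : seq I) (a : I -> nat) :
  (\prod_(i <- s) (a i)`! %| (\sum_(i <- s) a i)`!)%N.
Proof.
elim: s => [|i s IH]; first by rewrite !big_nil.
rewrite !big_cons -(bin_fact (leq_addr (\sum_(j <- s) a j) (a i))) addKn.
by rewrite dvdn_mull // dvdn_mul.
Qed.

Lemma symm_dvd r : (symm r %| (weight r)`!)%N.
Proof.
apply: dvdn_trans (prod_fact_dvd _ _ _).
apply: (big_ind2 dvdn) => // [a b c d|i _]; first exact: dvdn_mul.
exact: fact_expn_dvd.
Qed.

(** [inord] falls back to 0 on overflow: [incr] is faithful when [parts r < K], whereas [decr] never
    overflows. *)
Definition incr (i : 'I_N) r : {ffun 'I_N -> 'I_K.+1} :=
  [ffun j => inord (r j + (j == i))].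
Definition decr (i : 'I_N) r : {ffun 'I_N -> 'I_K.+1} :=
  [ffun j => inord (r j - (j == i))].

Lemma decrE i r j : decr i r j = (r j - (j == i))%N :> nat.
Proof. by rewrite ffunE inordK // ltnS (leq_trans (leq_subr _ _)) // -ltnS. Qed.

Lemma leq_parts r i : (r i <= parts r)%N.
Proof. by rewrite /parts (bigD1 i) //= leq_addr. Qed.

Lemma incrE i r j : (parts r < K)%N -> incr i r j = (r j + (j == i))%N :> nat.
Proof.
move=> rK; rewrite ffunE inordK // ltnS.
by have := leq_parts r j; case: (j == i); move: rK; lia.
Qed.

Lemma decrK i r : (0 < r i)%N -> incr i (decr i r) = r.
Proof.
move=> ri; apply/ffunP=> j; apply: val_inj; rewrite ffunE /= decrE.
have [->|_] := eqVneq j i; first by rewrite subnK // inordK.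
by rewrite subn0 addn0 inordK.
Qed.

Lemma incrK i r : (parts r < K)%N -> decr i (incr i r) = r.
Proof.
by move=> rK; apply/ffunP=> j; apply: val_inj; rewrite /= decrE incrE // addnK.
Qed.

Lemma parts_decr i r : (0 < r i)%N -> parts r = (parts (decr i r)).+1.
Proof.
move=> ri; rewrite /parts (bigD1 i) //= [in RHS](bigD1 i) //= decrE eqxx.
rewrite (eq_bigr (fun j : 'I_N => decr i r j : nat)).
  by rewrite subn1 -addSn prednK.
by move=> j /negPf ne; rewrite decrE ne subn0.
Qed.

Lemma weight_decr i r : (0 < r i)%N -> weight r = (i.+1 + weight (decr i r))%N.
Proof.
move=> ri; rewrite /weight (bigD1 i) //= [in RHS](bigD1 i) //= decrE eqxx.
rewrite (eq_bigr (fun j : 'I_N => j.+1 * decr i r j)%N); last first.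
  by move=> j /negPf ne; rewrite decrE ne subn0.
by rewrite addnA -mulnS subn1 prednK.
Qed.

Lemma symm_decr i r : (0 < r i)%N ->
  symm r = (r i * i.+1`! * symm (decr i r))%N.
Proof.
move=> ri; rewrite /symm (bigD1 i) //= [in RHS](bigD1 i) //= decrE eqxx.
rewrite (eq_bigr
  (fun j : 'I_N => (decr i r j)`! * j.+1`! ^ decr i r j)%N); last first.
  by move=> j /negPf ne; rewrite decrE ne subn0.
by rewrite subn1 -(prednK ri) /= factS expnS; ring.
Qed.

(** The number of set partitions of [weight r] elements with [r i] blocks of size i+1 for each i. *)
Definition mult r : nat := ((weight r)`! %/ symm r)%N.

Lemma multK r : (mult r * symm r)%N = (weight r)`!.
Proof. exact: divnK (symm_dvd r). Qed.

(** Both sides count such set partitions with one block of size i+1 distinguished; the proof clears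
    the denominator [symm r]. *)
Lemma mult_decr i r : (0 < r i)%N ->
  (mult r * r i = 'C(weight r, i.+1) * mult (decr i r))%N.
Proof.
move=> ri; apply/eqP; rewrite -(eqn_pmul2r (symm_gt0 r)) mulnAC multK.
rewrite (symm_decr i r ri) -mulnA (mulnCA (mult _)) multK.
have le : (i.+1 <= weight r)%N by rewrite (weight_decr i r ri) leq_addr.
have := bin_fact le; rewrite {2}(weight_decr i r ri) addKn => <-.
by apply/eqP; ring.
Qed.

(* Sum [mult_decr] over all parts, each counted with its size i+1: the sizes
   add up to n+1, which cancels. *)
Lemma mult_rec n r : weight r = n.+1 ->
  mult r = (\sum_(i < N | 0 < r i) 'C(n, i) * mult (decr i r))%N.
Proof.
move=> wr; apply/eqP; rewrite -(eqn_pmul2l (ltn0Sn n)) big_distrr /= -{1}wr.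
rewrite mulnC big_distrr /= [X in X == _](bigID (fun i => 0 < r i)%N) /=.
rewrite [X in (_ + X)%N]big1 ?addn0 => [|i]; last first.
  by rewrite lt0n negbK => /eqP ->; rewrite !muln0.
apply/eqP/eq_bigr => i ri; rewrite mulnCA mult_decr // wr.
by rewrite !mulnA mul_bin_diag.
Qed.

End Box.

(** * The Bell recurrence over a fixed box *)

Section BoxRecurrence.
Context {A : comNzRingType}.
Variable x : nat -> A.

(* [bell_at] with bounds on the sizes and multiplicities of the parts that do
   not depend on n and k. *)
Definition bell_box (N K n k : nat) : A :=
  \sum_(r : {ffun 'I_N -> 'I_K.+1} | (parts r == k) && (weight r == n))
    (mult r)%:R * \prod_(i < N) x i.+1 ^+ r i.

(** After [mult_rec] and an exchange of sums, removing the chosen part is a bijection. The bound on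
    N keeps [n - i] from being truncated; [k < K] leaves room to put the part back. *)
Lemma bell_box_rec N K n k : (N <= n.+1)%N -> (k < K)%N ->
  bell_box N K n.+1 k.+1 =
    \sum_(i < N) 'C(n, i)%:R * x i.+1 * bell_box N K (n - i) k.
Proof.
move=> leN ltK; rewrite /bell_box.
under eq_bigr => r /andP[_ /eqP wr].
  rewrite (mult_rec n r wr) natr_sum big_distrl /=; over.
rewrite (exchange_big_dep xpredT) //=; apply: eq_bigr => i _.
rewrite big_distrr /=.
have lti : (i <= n)%N by have := ltn_ord i; lia.
apply: (big_bij _ _ _ _ _ (decr i) (incr i)) => r.
  move=> /andP[/andP[/eqP pr /eqP wr] ri]; split; last 1 first.
  - rewrite natrM -!mulrA; congr (_ * _); rewrite mulrCA; congr (_ * _).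
    rewrite (bigD1 i) //= [in RHS](bigD1 i) //= decrE eqxx mulrA -exprS.
    rewrite subn1 prednK //; congr (_ * _); apply: eq_bigr => j /negPf ne.
    by rewrite decrE ne subn0.
  - by move: (parts_decr i r ri) (weight_decr i r ri); rewrite pr wr; lia.
  - exact: decrK.
move=> /andP[/eqP pr /eqP wr].
have rK : (parts r < K)%N by rewrite pr.
have ri : (0 < incr i r i)%N by rewrite incrE // eqxx addn1.
split; last exact: incrK.
rewrite ri (parts_decr i _ ri) (weight_decr i _ ri) incrK // pr wr.
by rewrite eqxx /= andbT; lia.
Qed.
End BoxRecurrence.

(** * Change of box *)

Lemma big_ord_narrow_idx (T : Type) (idx : T) (op : Monoid.com_law idx)
    (N N' : nat) (le : (N' <= N)%N) (F : 'I_N -> T) :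
  (forall i : 'I_N, (N' <= i)%N -> F i = idx) ->
  \big[op/idx]_(i < N) F i = \big[op/idx]_(i < N') F (widen_ord le i).
Proof.
move=> F0; rewrite (bigID (fun i : 'I_N => (i < N')%N)) /=.
rewrite [X in op _ X]big1 ?Monoid.mulm1 => [|i]; first exact: big_ord_narrow.
by rewrite -leqNgt; exact: F0.
Qed.

Section Resize.
Context {N K N' K' : nat}.

Definition fits (r : {ffun 'I_N -> 'I_K.+1}) :=
  (forall i : 'I_N, N' <= i -> r i = 0 :> nat)%N /\ (forall i, r i <= K')%N.

(** Weight minus number of parts is the sum of all i * r_i, so a single part of size i+1 > N' makes
    it at least N'. *)
Lemma fits_weight r :
  (weight r < N' + parts r)%N -> (parts r <= K')%N -> fits r.
Proof.
move=> wr pr; split=> i; last exact: leq_trans (leq_parts r i) pr.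
move=> lei; apply/eqP; rewrite -leqn0 leqNgt; apply/negP => ri.
have: (N' + parts r <= weight r)%N; last by lia.
have -> : weight r = (\sum_(j < N) j * r j + parts r)%N.
  by rewrite -big_split /=; apply: eq_bigr => j _; rewrite mulSn addnC.
rewrite leq_add2r (bigD1 i) //=; apply: leq_trans (leq_addr _ _).
by apply: leq_trans lei _; rewrite leq_pmulr.
Qed.

Variable leN : (N' <= N)%N.

Definition shrink (r : {ffun 'I_N -> 'I_K.+1}) : {ffun 'I_N' -> 'I_K'.+1} :=
  [ffun i : 'I_N' => inord (r (widen_ord leN i))].
Definition enlarge (r : {ffun 'I_N' -> 'I_K'.+1}) : {ffun 'I_N -> 'I_K.+1} :=
  [ffun i : 'I_N => inord
    (oapp (fun j : 'I_N' => nat_of_ord (r j)) 0%N (insub (nat_of_ord i)))].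

Lemma shrinkE r i : fits r -> shrink r i = r (widen_ord leN i) :> nat.
Proof. by case=> _ rK; rewrite ffunE inordK // ltnS. Qed.

Lemma shrink_big (T : Type) (idx : T) (op : Monoid.com_law idx)
    (F : nat -> nat -> T) r : fits r -> (forall i, F i 0%N = idx) ->
  \big[op/idx]_(i < N') F i (shrink r i) = \big[op/idx]_(i < N) F i (r i).
Proof.
move=> fr F0; rewrite (big_ord_narrow_idx _ _ _ _ _ leN).
  by apply: eq_bigr => i _; rewrite shrinkE.
by move=> i /(fr.1 i) ->.
Qed.

Lemma parts_shrink r : fits r -> parts (shrink r) = parts r.
Proof. by move=> fr; apply: (shrink_big _ _ _ (fun=> id)). Qed.

Lemma weight_shrink r : fits r -> weight (shrink r) = weight r.
Proof.
move=> fr; apply: (shrink_big _ _ _ (fun i c => i.+1 * c)%N) => // i.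
exact: muln0.
Qed.

Lemma mult_shrink r : fits r -> mult (shrink r) = mult r.
Proof.
move=> fr; rewrite /mult weight_shrink //; congr (_ %/ _)%N.
by apply: (shrink_big _ _ _ (fun i c => c`! * i.+1`! ^ c)%N).
Qed.

Lemma shrinkK r : fits r -> enlarge (shrink r) = r.
Proof.
move=> fr; apply/ffunP => i; apply: val_inj; rewrite /= ffunE.
case: insubP => [j lt_i ji|]; last first.
  by rewrite -leqNgt /= => /(fr.1 i) ->; rewrite inordK.
rewrite /= shrinkE // (_ : widen_ord leN j = i) ?inordK //.
exact: val_inj.
Qed.

Lemma enlargeE r i : (K' <= K)%N -> enlarge r (widen_ord leN i) = r i :> nat.
Proof.
move=> leK; rewrite ffunE /= valK /= inordK //.
by apply: leq_trans (ltn_ord _) _; rewrite ltnS.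
Qed.

Lemma enlarge_fits r : (K' <= K)%N -> fits (enlarge r).
Proof.
move=> leK; split=> i.
  by move=> lei; rewrite ffunE insubN -?leqNgt //= inordK.
rewrite ffunE; case: insubP => [j _ _|_] /=; last by rewrite inordK.
rewrite inordK; first by rewrite -ltnS.
by apply: leq_trans (ltn_ord _) _; rewrite ltnS.
Qed.

Lemma enlargeK r : (K' <= K)%N -> shrink (enlarge r) = r.
Proof.
move=> leK; apply/ffunP => i; apply: val_inj.
by rewrite /= shrinkE ?enlargeE //; exact: enlarge_fits.
Qed.

End Resize.

(** * The recurrence for Bell polynomials *)

Section Recurrence.
Context {A : comNzRingType}.
Variable x : nat -> A.

(** The box in [bell_at] varies with n and k, which obstructs a recurrence. For k > 0 the parts have
    size at most n-k+1 <= N, so every large enough box gives the same sum. *)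
Lemma bell_at_boxE N K n k : (n < N + k)%N -> (k <= K)%N ->
  bell_at x n k = bell_box x N K n k.
Proof.
move=> leN leK; rewrite /bell_at /bell_box; case: eqP => [k0|/eqP k_gt0].
  subst k; rewrite addn0 in leN.
  have parts0 r : parts r = 0%N -> r = [ffun=> ord0] :> {ffun 'I_N -> 'I_K.+1}.
    move=> pr; apply/ffunP => i; apply: val_inj; rewrite /= ffunE /=.
    by apply/eqP; rewrite -leqn0 -pr leq_parts.
  have parts00 : parts ([ffun=> ord0] : {ffun 'I_N -> 'I_K.+1}) = 0%N.
    by rewrite /parts big1 // => i _; rewrite ffunE.
  have weight00 : weight ([ffun=> ord0] : {ffun 'I_N -> 'I_K.+1}) = 0%N.
    by rewrite /weight big1 // => i _; rewrite ffunE muln0.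
  have [->|n0] := eqVneq n 0%N; last first.
    rewrite big_pred0 // => r; apply/andP => -[/eqP /parts0 ->].
    by rewrite weight00 eq_sym (negPf n0).
  rewrite (big_pred1 [ffun=> ord0]) => [|r /=].
    rewrite /mult /symm weight00 !big1 ?mul1r // => i _; rewrite ffunE //.
  apply/andP/eqP => [[/eqP /parts0] //|->].
  by rewrite parts00 weight00.
case: ltnP => [lt_nk|le_kn].
  rewrite big_pred0 // => r; apply/andP => -[/eqP pr /eqP wr].
  suff: (parts r <= weight r)%N by rewrite pr wr leqNgt lt_nk.
  by apply: leq_sum => i _; rewrite leq_pmull.
have leN' : (n - k + 1 <= N)%N by lia.
have fitP (r : {ffun 'I_N -> 'I_K.+1}) : parts r = k -> weight r = n ->
    fits (N' := n - k + 1) (K' := k) r.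
  by move=> pr wr; apply: fits_weight; rewrite pr ?wr; lia.
apply: (big_bij _ _ _ _ _ enlarge (shrink leN')) => r; last first.
  move=> /andP[/eqP pr /eqP wr]; have fr := fitP _ pr wr.
  split; last exact: shrinkK.
  move: (parts_shrink leN' r fr) (weight_shrink leN' r fr).
  by rewrite pr wr /parts /weight => -> ->; rewrite !eqxx.
move=> /andP[/eqP pr /eqP wr].
have fr := enlarge_fits (N := N) r leK; have rK := enlargeK leN' r leK.
have pE := parts_shrink leN' _ fr; have wE := weight_shrink leN' _ fr.
have mE := mult_shrink leN' _ fr.
have xE :=
  shrink_big leN' _ _ _ (fun i c => x i.+1 ^+ c) _ fr (fun i => expr0 _).
move: pE wE mE xE; rewrite rK => <- <- <- <-.
rewrite /mult [in weight r]/weight wr; split=> //.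
by rewrite /parts pr !eqxx.
Qed.

Lemma bell_at_lt n k : (n < k)%N -> bell_at x n k = 0.
Proof. by rewrite /bell_at => lt; rewrite lt; case: eqP lt => // ->. Qed.

Lemma bell_at0 n : bell_at x n 0 = (n == 0%N)%:R.
Proof. by []. Qed.

(** The binomial vanishes for i > n, so M is free above n; one range then serves all the sums
    exchanged below. *)
Lemma bell_at_rec M n k : (n < M)%N ->
  bell_at x n.+1 k.+1 =
    \sum_(i < M) 'C(n, i)%:R * x i.+1 * bell_at x (n - i) k.
Proof.
move=> ltM; rewrite (big_ord_narrow_idx _ _ _ _ _ ltM).
  rewrite (bell_at_boxE n.+1 k.+1) //; last by lia.
  rewrite bell_box_rec //; apply: eq_bigr => i _.
  by rewrite -bell_at_boxE //; have := ltn_ord i; lia.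
by move=> i lt_i; rewrite bin_small // !mul0r.
Qed.

(** * Derivations of Bell polynomials *)

Variable d : A -> A.
Hypothesis dD : {morph d : a b / a + b}.
Hypothesis dM : forall a b, d (a * b) = d a * b + a * d b.

Lemma derivation0 : d 0 = 0.
Proof. by apply: (addrI (d 0)); rewrite -dD !addr0. Qed.

Lemma derivation1 : d 1 = 0.
Proof.
have := dM 1 1; rewrite !mulr1 mul1r => d11.
by apply: (addrI (d 1)); rewrite -d11 addr0.
Qed.

Lemma derivation_nat n : d n%:R = 0.
Proof.
by elim: n => [|n IH]; rewrite ?derivation0 // -natr1 dD IH derivation1 addr0.
Qed.

Lemma derivation_sum (I : Type) (s : seq I) (F : I -> A) :
  d (\sum_(i <- s) F i) = \sum_(i <- s) d (F i).
Proof. exact: (big_morph d dD derivation0). Qed.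

(** Both sides count pairs of disjoint subsets of sizes i and j. This exchanges the part split off
    with the part differentiated. *)
Lemma bin_triple n i j : ('C(n, i) * 'C(n - i, j) = 'C(n, j) * 'C(n - j, i))%N.
Proof.
have [le|gt] := leqP (i + j) n; last first.
  have small a b : (n < a + b)%N -> ('C(n, a) * 'C(n - a, b) = 0)%N.
    move=> lt; have [le_a|lt_a] := leqP a n; last by rewrite bin_small.
    by rewrite ['C(n - a, b)]bin_small ?muln0 //; lia.
  by rewrite !small // addnC.
have pos : (0 < i`! * (j`! * (n - i - j)`!))%N by rewrite !muln_gt0 !fact_gt0.
apply/eqP; rewrite -(eqn_pmul2r pos); apply/eqP.
have fi := @bin_fact n i; have fj := @bin_fact n j.
have fij := @bin_fact (n - i) j; have fji := @bin_fact (n - j) i.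
have -> : (n - i - j = n - j - i)%N by lia.
have eij : (n - i - j = n - j - i)%N by lia.
rewrite eij in fij.
transitivity n`!.
  by rewrite -fi ?(leq_trans _ le) ?leq_addr // -fij; [ring|lia].
by rewrite -fj ?(leq_trans _ le) ?leq_addl // -fji; [ring|lia].
Qed.

Lemma bell_at_derivation M n k : (n <= M)%N ->
  d (bell_at x n k.+1) =
    \sum_(j < M) 'C(n, j.+1)%:R * d (x j.+1) * bell_at x (n - j.+1) k.
Proof.
elim: k n => [|k IH] [|n] leM;
  try by rewrite bell_at_lt // derivation0 big1 // => j _;
         rewrite bin0n !mul0r.
  (* For k = 0 only i = n survives: B_{n-i,0} is 0 for i < n, and the binomial is 0 for i > n. *)
  rewrite (bell_at_rec _ _ _ leM) derivation_sum; apply: eq_bigr => i _.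
  rewrite !dM !derivation_nat mul0r add0r mulr0 addr0 subSS.
  have [lt|gt|->] := ltngtP (i : nat) n; last by rewrite !binn.
    by rewrite bell_at0 subn_eq0 leqNgt lt !mulr0.
  by rewrite !bin_small // !mul0r.
rewrite (bell_at_rec _ _ _ leM) derivation_sum.
under eq_bigr => i _.
  rewrite !dM derivation_nat mul0r add0r.
  rewrite (IH (n - i)%N) ?(leq_trans (leq_subr _ _)) ?(ltnW leM) //.
  rewrite mulr_sumr; over.
rewrite big_split exchange_big -big_split; apply: eq_bigr => j _ /=.
(* Once the differentiated factor is pulled out, the sum over i is the recurrence for
   B_{n-j,k+1}. *)
under [X in _ + X]eq_bigr => i _.
  rewrite (_ : _ * _ = 'C(n, j.+1)%:R * d (x j.+1)
    * ('C(n - j.+1, i)%:R * x i.+1 * bell_at x (n - j.+1 - i) k)).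
    by over.
  rewrite -subnDA addnC subnDA.
  transitivity (('C(n, i) * 'C(n - i, j.+1))%:R * x i.+1 * d (x j.+1)
    * bell_at x (n - j.+1 - i) k); first by rewrite natrM; ring.
  by rewrite bin_triple natrM; ring.
(* Pascal's rule merges the two Leibniz sums. *)
rewrite -mulr_sumr subSS binS natrD !mulrDl addrC; congr (_ + _).
have [lt|le] := ltnP j n; last by rewrite bin_small // !mul0r.
by rewrite -bell_at_rec ?subnSK //; lia.
Qed.
End Recurrence.

(** * Bell polynomials with vanishing first variable *)

Lemma bell_at_lt_double (A : comNzRingType) (x : nat -> A) n k :
  x 1%N = 0 -> (n < k.*2)%N -> bell_at x n k = 0.
Proof.
move=> x1; elim: k n => // k IH [|n] lt; first exact: bell_at_lt.
(* A part of size 1 carries [x 1 = 0]; splitting off any other lowers the size by at least 2. *)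
rewrite (bell_at_rec _ n.+1) // big1 // => -[[|i] lti] _ /=.
  by rewrite x1 mulr0 mul0r.
by rewrite IH ?mulr0 //; move: lt lti; rewrite doubleS; lia.
Qed.

(** Were d x_1 equal to x_2, [bell_at_derivation] would be the recurrence for B_{n+1,k+1}; the
    subtracted term corrects for d x_1 = 0. *)
Lemma bell_at_shift (A : comNzRingType) (x : nat -> A) (d : A -> A) M n k :
  {morph d : f g / f + g} -> (forall f g, d (f * g) = d f * g + f * d g) ->
  x 1%N = 0 -> (forall j, (1 < j <= M)%N -> d (x j) = x j.+1) ->
  (n <= M + k)%N ->
  d (bell_at x n k.+1) =
    bell_at x n.+1 k.+1 - n%:R * x 2%N * bell_at x n.-1 k.
Proof.
move=> dD dM x1 dx le_n; rewrite (bell_at_rec _ n.+1) // big_ord_recl /= x1.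
rewrite mulr0 mul0r add0r (bell_at_derivation _ _ dD dM n) //.
case: n le_n => [|n] le_n; first by rewrite !big_ord0 !mul0r subr0.
rewrite big_ord_recl [in RHS]big_ord_recl /= !bin1 !subSS !subn0.
rewrite x1 (derivation0 _ dD) mulr0 mul0r add0r addrAC subrr add0r.
apply: eq_bigr => j _; rewrite /bump !add1n subSS.
have [lt|le] := ltnP j.+1 M; first by rewrite dx.
(* For j+2 > M nothing is known of d x_{j+2}, but fewer than k elements remain for k parts, so the
   Bell factor is 0. *)
have [lt|ge] := ltnP j.+1 n.+1; last by rewrite !bin_small // !mul0r.
by rewrite bell_at_lt ?mulr0 //; lia.
Qed.

(** * The closed form satisfies the Stirling recurrence *)

(* Stated over an abstract ring: conversion in [laurent] is very slow. *)
Section Step.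
Context {A : comNzRingType}.
Variables (X1 X2 : A) (b : nat -> nat -> A) (d : A -> A).
Hypothesis b0 : forall n, b n 0 = (n == 0%N)%:R.
Hypothesis b_small : forall n k, (n < k.*2)%N -> b n k = 0.
Hypothesis dD : {morph d : f g / f + g}.
Hypothesis dM : forall f g, d (f * g) = d f * g + f * d g.
Hypothesis dX1 : d X1 = X2.

(** The claimed value of S_{m+1,q+1}, with s = m - r. For q <= m the terms with s > m - q vanish by
    [b_small], so the range need not depend on q. *)
Definition stirling_sum (m q : nat) : A :=
  \sum_(s < m.+1)
    (-1) ^+ s * 'C(m + s, q)%:R * X1 ^+ (m - s) * b (m - q + s) s.

Lemma derivationX f n : d (f ^+ n) = n%:R * d f * f ^+ n.-1.
Proof.
elim: n => [|n IH]; first by rewrite mul0r mul0r (derivation1 _ dM).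
rewrite exprS dM IH /= -natr1; case: n {IH} => [|n]; first by rewrite /=; ring.
by rewrite /= exprS; ring.
Qed.

Lemma derivation_opp f : d (- f) = - d f.
Proof. by apply: (addrI (d f)); rewrite -dD !subrr (derivation0 _ dD). Qed.

Lemma derivation_sign s : d ((-1) ^+ s) = 0.
Proof.
by rewrite derivationX derivation_opp (derivation1 _ dM) oppr0 mulr0 mul0r.
Qed.

Variables m q : nat.
Hypothesis le_qm : (q <= m)%N.
Hypothesis db : forall s, (s <= m)%N ->
  d (b (m - q + s.+1) s.+1) =
    b (m - q + s.+2) s.+1 - (m - q + s.+1)%:R * X2 * b (m - q + s) s.

(** The first sum differentiates the power of X_1; the others come from the two terms of [db], the
    last with s shifted by one, which flips its sign. *)
Lemma derivation_stirling_sum :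
  X1 * d (stirling_sum m q) =
    \sum_(s < m.+1) (-1) ^+ s * ('C(m + s, q) * (m - s))%:R * X1 ^+ (m - s)
        * X2 * b (m - q + s) s
    + \sum_(s < m.+2) (-1) ^+ s * 'C(m + s, q)%:R * X1 ^+ (m.+1 - s)
        * b (m - q + s.+1) s
    + \sum_(s < m.+1) (-1) ^+ s * ('C(m + s.+1, q) * (m - q + s.+1))%:R
        * X1 ^+ (m - s) * X2 * b (m - q + s) s.
Proof.
have dE s : (s < m.+2)%N ->
    (-1) ^+ s * 'C(m + s, q)%:R * X1 ^+ (m.+1 - s) * d (b (m - q + s) s) =
    (-1) ^+ s * 'C(m + s, q)%:R * X1 ^+ (m.+1 - s) * b (m - q + s.+1) s
    + (if s is t.+1 then
      (-1) ^+ t * ('C(m + t.+1, q) * (m - q + t.+1))%:R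
        * X1 ^+ (m - t) * X2 * b (m - q + t) t else 0).
  case: s => [|t] lt_t; last first.
    by rewrite db // subSS natrM exprS; ring.
  by rewrite !b0 (derivation_nat _ dD dM) addn1 /= !mulr0 addr0.
(* Allows the range to be extended to s = m+1. *)
have big0 : d (b (m - q + m.+1) m.+1) = 0.
  by rewrite b_small ?(derivation0 _ dD) // -addnn; lia.
have termE (s : 'I_m.+1) :
    X1 * d ((-1) ^+ s * 'C(m + s, q)%:R * X1 ^+ (m - s) * b (m - q + s) s) =
    (-1) ^+ s * ('C(m + s, q) * (m - s))%:R * X1 ^+ (m - s) * X2
      * b (m - q + s) s
    + (-1) ^+ s * 'C(m + s, q)%:R * X1 ^+ (m.+1 - s) * d (b (m - q + s) s).
  rewrite 3!dM derivation_sign (derivation_nat _ dD dM) derivationX dX1.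
  rewrite natrM subSn; last by rewrite -ltnS.
  by rewrite exprS; case: (m - s)%N => [|e]; rewrite ?exprS /=; ring.
rewrite (derivation_sum _ dD) mulr_sumr (eq_bigr _ (fun s _ => termE s)).
rewrite big_split -addrA; congr (_ + _).
transitivity (\sum_(s < m.+2)
    (-1) ^+ s * 'C(m + s, q)%:R * X1 ^+ (m.+1 - s) * d (b (m - q + s) s)).
  by rewrite [RHS]big_ord_recr /= big0 mulr0 addr0.
rewrite (eq_bigr _ (fun s _ => dE _ (ltn_ord s))) big_split; congr (_ + _).
by rewrite big_ord_recl /= add0r; apply: eq_bigr.
Qed.

Lemma stirling_sum_rec :
  - ((2 * m.+1)%:R - 1) * X2 * stirling_sum m q
    + X1 * ((if q is p.+1 then stirling_sum m p else 0)
            + d (stirling_sum m q)) = stirling_sum m.+1 q.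
Proof.
have prevE : X1 * (if q is p.+1 then stirling_sum m p else 0) =
    \sum_(s < m.+2) (-1) ^+ s * (if q is p.+1 then 'C(m + s, p) else 0%N)%:R
      * X1 ^+ (m.+1 - s) * b (m - q + s.+1) s.
  case: q le_qm => [|p] lt_pm.
    by rewrite mulr0 big1 // => s _; rewrite mulr0 !mul0r.
  (* The extra term s = m+1 is 0, as 2m+1-p < 2(m+1). *)
  rewrite big_ord_recr /= [X in _ + X]mulrC b_small ?mul0r ?addr0; last first.
    by rewrite -addnn; lia.
  rewrite mulr_sumr; apply: eq_bigr => s _.
  rewrite subSn -1?ltnS // exprS (_ : m - p + s = m - p.+1 + s.+1)%N; last lia.
  by ring.
rewrite mulrDr prevE derivation_stirling_sum -/(stirling_sum m q).
(* Pascal's rule for C(m+1+s,q); the [if] is C(m+s,q-1), read as 0 at q = 0. *)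
have -> : stirling_sum m.+1 q =
    \sum_(s < m.+2) (-1) ^+ s * (if q is p.+1 then 'C(m + s, p) else 0%N)%:R
      * X1 ^+ (m.+1 - s) * b (m - q + s.+1) s
    + \sum_(s < m.+2) (-1) ^+ s * 'C(m + s, q)%:R * X1 ^+ (m.+1 - s)
        * b (m - q + s.+1) s.
  rewrite -big_split; apply: eq_bigr => s _ /=.
  rewrite (_ : m.+1 - q + s = m - q + s.+1)%N; last by lia.
  rewrite -!mulrDl -mulrDr -natrD; congr (_ * _%:R * _ * _).
  by case: q => [|p]; rewrite ?bin0 // addSn binS addnC.
rewrite /stirling_sum mulr_sumr.
set P := \sum_(s < m.+2) _; set Q := \sum_(s < m.+2) _.
set U := \sum_(s < m.+1) _; set V := \sum_(s < m.+1) _.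
set W := \sum_(s < m.+1) _.
(* The terms with X_2 have coefficients -(2m+1), m-s and m+s+1 times C(m+s,q), which add up to 0. *)
suff cancel : U + V + W = 0.
  by rewrite -[RHS]addr0 -cancel; ring.
rewrite -!big_split big1 // => s _ /=.
have binE : ('C(m + s.+1, q) * (m - q + s.+1) = (m + s.+1) * 'C(m + s, q))%N.
  rewrite mulnC [RHS](_ : _ = (m + s.+1) * 'C((m + s.+1).-1, q))%N ?addnS //.
  by rewrite mul_bin_down; congr (_ * _)%N; lia.
rewrite binE !natrM natrB ?natrD -?natr1; last by rewrite -ltnS.
by ring.
Qed.
End Step.

(** * Induction from the recurrence to the closed form *)

Section Closed.
Context {A : comNzRingType}.
Variables (X1 : A) (x : nat -> A) (D : nat -> A -> A) (S : nat -> nat -> A).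
Hypothesis DD : forall M, {morph D M : f g / f + g}.
Hypothesis DM : forall M f g, D M (f * g) = D M f * g + f * D M g.
Hypothesis x1 : x 1%N = 0.
Hypothesis DX1 : forall M, (0 < M)%N -> D M X1 = x 2%N.
Hypothesis Dx : forall M j, (1 < j <= M)%N -> D M (x j) = x j.+1.
Hypothesis S00 : X1 * S 0 0 = 1.
Hypothesis Sn0 : forall n, S n.+1 0 = 0.
Hypothesis S_lt : forall n k, (n < k)%N -> S n k = 0.
Hypothesis S_rec : forall n k, (k <= n)%N ->
  S n.+1 k.+1 = - ((2 * n)%:R - 1) * x 2%N * S n k.+1
    + X1 * (S n k + D (n - k) (S n k.+1)).

Lemma stirling_sum_diag m : stirling_sum X1 (bell_at x) m m = X1 ^+ m.
Proof.
rewrite /stirling_sum big_ord_recl big1 => [|s _].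
  by rewrite /= addn0 binn subnn subn0 !mul1r mulr1 addr0.
by rewrite subnn bell_at_lt_double ?mulr0 //= /bump; lia.
Qed.

Lemma stirling_sumE m q : (q <= m)%N ->
  S m.+1 q.+1 = stirling_sum X1 (bell_at x) m q.
Proof.
elim: m q => [|m IH] q le_q; rewrite S_rec //.
  have -> : q = 0%N by lia.
  rewrite stirling_sum_diag (S_lt 0 1) // mulr0 add0r.
  by rewrite (derivation0 _ (DD _)) addr0 S00.
(* [stirling_sum_rec] needs q <= m. At q = m+1 the recurrence is just multiplication by X_1, since
   S_{m+1,m+2} = 0. *)
have [->|ne] := eqVneq q m.+1.
  rewrite S_lt // mulr0 add0r (derivation0 _ (DD _)) addr0.
  by rewrite IH // !stirling_sum_diag exprS.
have le : (q <= m)%N by lia.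
rewrite (IH _ le) (_ : S m.+1 q = if q is p.+1 then
    stirling_sum X1 (bell_at x) m p else 0); last first.
  by case: q {le_q ne} le => // p lt_p; apply/IH/ltnW.
apply: (stirling_sum_rec X1 (x 2%N)) => //.
- by move=> n k; apply: bell_at_lt_double.
- by apply: DX1; lia.
(* The bound is attained: m-q+s+1 = (m+1-q) + s, so the truncated derivation is just long enough. *)
move=> s le_s; rewrite (bell_at_shift _ _ _ (m.+1 - q)) //; last by lia.
  by rewrite [in X in _ - _ * X]addnS /= -addnS.
by move=> j; apply: Dx.
Qed.

Lemma stirling_closed_form n k : (1 <= k)%N -> (k <= n)%N ->
  S n k =
    \sum_(k.-1 <= r < n)
      (-1) ^+ (n - 1 - r) * 'C(2 * n - 2 - r, k - 1)%:R * X1 ^+ r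
        * bell_at x (2 * n - 1 - k - r) (n - 1 - r).
Proof.
case: n k => [|m] [|q] // _ le_q.
rewrite stirling_sumE // big_geq_mkord big_mkcond /stirling_sum.
rewrite (reindex_inj rev_ord_inj); apply: eq_bigr => r _.
have le_r : (r <= m)%N by rewrite -ltnS.
have -> : nat_of_ord (rev_ord r) = (m - r)%N by [].
have -> : (m.+1 - 1 - r = m - r)%N by lia.
have -> : (2 * m.+1 - 2 - r = m + (m - r))%N by lia.
have -> : (2 * m.+1 - 1 - q.+1 - r = m - q + (m - r))%N by lia.
(* The indices r < q, absent from the stated sum, contribute 0. *)
rewrite subKn // subn1 /=; case: leqP => // lt_rq.
by rewrite bell_at_lt_double ?mulr0 // -addnn; lia.
Qed.

End Closed.

(** * The truncated shift derivation on Laurent polynomials *)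

Lemma sum_derivationM (A : comNzRingType) (I : Type) (s : seq I) (c : I -> A)
    (d : I -> A -> A) :
  (forall i f g, d i (f * g) = d i f * g + f * d i g) ->
  forall f g, \sum_(i <- s) c i * d i (f * g) =
    (\sum_(i <- s) c i * d i f) * g + f * (\sum_(i <- s) c i * d i g).
Proof.
move=> dM f g; rewrite mulr_suml mulr_sumr -big_split; apply: eq_bigr => i _ /=.
by rewrite dM mulrDr mulrA mulrCA.
Qed.

Lemma sum_derivationD (A : comNzRingType) (I : Type) (s : seq I) (c : I -> A)
    (d : I -> A -> A) :
  (forall i, {morph d i : f g / f + g}) ->
  {morph (fun f => \sum_(i <- s) c i * d i f) : f g / f + g}.
Proof.
move=> dD f g; rewrite -big_split; apply: eq_bigr => i _ /=.
by rewrite dD mulrDr.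
Qed.

(** Here [e j] stands for the partial derivative of X_i with respect to X_j. *)
Lemma sum_dual (A : comNzRingType) (M i : nat) (c e : nat -> A) :
  (forall j, (0 < j)%N -> e j = (i == j)%:R) -> (0 < i <= M)%N ->
  \sum_(1 <= j < M.+1) c j * e j = c i.
Proof.
move=> eE iM; rewrite (bigD1_seq i) ?iota_uniq ?mem_index_iota //=.
rewrite big_seq_cond big1 => [|j /andP[]].
  by rewrite eE ?eqxx ?mulr1 ?addr0 //; case/andP: iM.
rewrite mem_index_iota => /andP[j0 _] /negPf ji.
by rewrite eE // eq_sym ji mulr0.
Qed.

Definition bell_seq (i : nat) : laurent := if i == 1%N then 0 else X i.

Definition shift_deriv (M : nat) (f : laurent) : laurent :=
  \sum_(1 <= j < M.+1) X j.+1 * pderiv j f.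

Lemma shift_derivD M : {morph shift_deriv M : f g / f + g}.
Proof. exact: sum_derivationD pderivD. Qed.

Lemma shift_derivM M f g :
  shift_deriv M (f * g) = shift_deriv M f * g + f * shift_deriv M g.
Proof. exact: sum_derivationM pderivM _ _. Qed.

Lemma shift_derivX M i : (0 < i <= M)%N -> shift_deriv M (X i) = X i.+1.
Proof.
move=> iM; apply: (sum_dual laurent M i (fun j => X j.+1)) => // j j0.
by apply: pderivX => //; case/andP: iM.
Qed.

Lemma stirling_lt n k : (n < k)%N -> stirling n k = 0.
Proof.
case: n => [|n] lt /=; first by case: k lt.
by rewrite lt orbT.
Qed.

Lemma stirling_rec n k : (k <= n)%N ->
  stirling n.+1 k.+1 =
    - ((2 * n)%:R - 1) * X 2 * stirling n k.+1
    + X 1 * (stirling n k + shift_deriv (n - k) (stirling n k.+1)).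
Proof. by move=> le_kn; rewrite /= ltnS ltnNge le_kn. Qed.

Theorem theorem6p1 (n k : nat) (k_ge1 : (1 <= k)%N) (k_le_n : (k <= n)%N) :
  stirling n k =
    \sum_(k.-1 <= r < n)
      (-1) ^+ (n - 1 - r) * 'C(2 * n - 2 - r, k - 1)%:R * X 1 ^+ r
        * assoc_bell (2 * n - 1 - k - r) (n - 1 - r).
Proof.
apply: (stirling_closed_form (X 1) bell_seq shift_deriv stirling
  shift_derivD shift_derivM (erefl _) _ _ X1invK _ stirling_lt stirling_rec)
  => // M.
(* The powers keep the true X_1, which is sent to X_2, whereas [bell_seq 1] is 0. *)
- by move=> M0; apply: shift_derivX.
by move=> j /andP[]; case: j => [|[|j]] // _ le_jM; apply: shift_derivX.
Qed.
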